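(* For any network $\mathcal N(G,\pi,p)$ (feedforward ReLU network with shared weights), consider $\mathcal N(G,\pi,\tilde p)$ where for any $i$, $\tilde p_i=p_i^2$. Define the function $g:\mathbb R^{|V_{\rm in}|}\to\mathbb R$ to be the sum of outputs of this network: $g(x)=\sum_{i=1}^{|V_{\rm out}|}f_{\tilde p}(x)[i]$. Then $\kappa^{(1)}$ and $\kappa^{(2)}$ can be calculated as follows, where $\mathbf 1$ is the all-ones input vector: $$\kappa^{(1)}(p)=\nabla_{\tilde p}\,g(\mathbf 1),\qquad \kappa^{(2)}_i(p)=\sum_{\substack{(u\to v),(u'\to v')\in E_i\\(u\to v)\ne(u'\to v')}}\tilde p_i\,\frac{\partial g(\mathbf 1)}{\partial h_{v'}(\tilde p)}\,\frac{\partial h_{u'}(\tilde p)}{\partial h_v(\tilde p)}\,h_u(\tilde p).$$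
   Context: A feedforward network with shared weights $\mathcal N(G,\pi,p)$ is given by a directed acyclic graph $G=(V,E)$ with input nodes $V_{\rm in}$ (no incoming edges) and output nodes $V_{\rm out}$ (no outgoing edges), a parameter vector $p$, and a map $\pi$ from edges to parameter indices, with edge weights $w_e=p_{\pi(e)}$ and $E_i=\{e\in E:\pi(e)=i\}$. It computes $f_p$: input nodes output the coordinates of the input, internal nodes output $h_v=\max\big(0,\sum_{(u\to v)\in E}w_{u\to v}h_u\big)$, output nodes output $h_v=\sum_{(u\to v)\in E}w_{u\to v}h_u$, and the values at the output nodes are the coordinates of $f_p(x)$. $h_u(\tilde p)$ denotes the output of node $u$ in $\mathcal N(G,\pi,\tilde p)$ on input $\mathbf 1$. $\mathcal P$ is the set of directed paths $\zeta=(\zeta_0,\dots,\zeta_{{\rm len}(\zeta)})$ from input nodes to output nodes, and $e\in\zeta$ means $e=(\zeta_j\to\zeta_{j+1})$ for some $j$. The quantities $\kappa^{(1)}=(\kappa^{(1)}_i)_i$ and $\kappa^{(2)}=(\kappa^{(2)}_i)_i$ are given by $$\kappa^{(1)}_i(p)=\sum_{e\in E_i}\sum_{\zeta\in\mathcal P}\mathbf 1_{e\in\zeta}\prod_{\substack{0\le j\le{\rm len}(\zeta)-1\\ e\ne(\zeta_j\to\zeta_{j+1})}}p^2_{\pi(\zeta_j\to\zeta_{j+1})},$$ $$\kappa^{(2)}_i(p)=p_i^2\sum_{\substack{e_1,e_2\in E_i\\ e_1\ne e_2}}\sum_{\zeta\in\mathcal P}\mathbf 1_{e_1,e_2\in\zeta}\prod_{\substack{0\le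 j\le{\rm len}(\zeta)-1\\ e_1\ne(\zeta_j\to\zeta_{j+1}),\ e_2\ne(\zeta_j\to\zeta_{j+1})}}p^2_{\pi(\zeta_j\to\zeta_{j+1})},$$ where $\mathbf 1_{A}$ is the indicator of the condition $A$.
   Formalization: The sum over e1≠e2 in κ^(2) is taken over unordered pairs (with ordered pairs the identity is off by a factor 2), and derivatives at a zero parameter or zero node value are right derivatives, since two-sided ones need not exist there. *)

(* Defs.v *)
From mathcomp Require Export all_boot all_order all_algebra.
From mathcomp Require Export boolp classical_sets cardinality fsbigop reals.
From mathcomp Require Export set_interval topology normedtype derive.

Set Implicit Arguments.
Unset Strict Implicit.
Unset Printing Implicit Defensive.

Import Order.TTheory GRing.Theory Num.Theory.
Export numFieldNormedType.Exports.

Local Open Scope classical_set_scope.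
Local Open Scope ring_scope.

(* One-sided derivatives.  The squared parameters are nonnegative, and on the
   all-ones input so is the value of every node; at a zero value a ReLU network
   need not be differentiable, but it is along the nonnegative values.  All
   derivatives are therefore taken relative to the domain D of the variable:
   the limit of the library's difference quotient, over the increments that
   stay in D.  This is 'D_v f a when D is a neighbourhood of a, see
   [derive_withinE], and a right derivative at the end point of [0, +oo[. *)
Section DeriveWithin.
Context {R : realType} {V : normedModType R}.
Implicit Types (D : set V) (f : V -> R) (a v : V).

Definition diff_quotient f a v : R -> R :=
  fun h => h^-1 *: ((f \o shift a) (h *: v) - f a).

Definition increments D a v : set_system R :=
  within [set h | D (h *: v + a)] 0^'.

Definition derivable_within D f a v : Prop :=
  cvg (diff_quotient f a v @ increments D a v).

Definition derive_within D f a v : R :=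
  lim (diff_quotient f a v @ increments D a v).

Lemma derive_withinE D f a v : nbhs a D ->
  (derivable_within D f a v <-> derivable f a v) /\
  derive_within D f a v = 'D_v f a.
Proof.
move=> aD; suff incE : increments D a v = 0^'.
  by rewrite /derivable_within /derive_within incE.
apply/seteqP; split=> P; last exact: cvg_within.
rewrite /increments /within /= => HP.
have cont : (fun h : R => h *: v + a) @ (0 : R) --> a.
  rewrite -[X in _ --> X]add0r -(scale0r v).
  by apply: cvgD; [apply: cvgZr_tmp; exact: cvg_id|exact: cvg_cst].
have := cont _ aD; move=> /(@nbhs_dnbhs _ (0 : R)) DD.
by apply: filterS2 DD HP => h /= Dh; apply.
Qed.

End DeriveWithin.

Definition nonneg_row {R : realType} m : set 'rV[R]_m :=
  [set q | forall i, 0 <= q 0 i].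

Definition gradient_within {R : realType} m (D : set 'rV[R]_m)
    (f : 'rV[R]_m -> R) (a : 'rV[R]_m) : 'rV[R]_m :=
  \row_i derive_within D f a (delta_mx 0 i).

(* The architecture (G, pi) of a network with m shared parameters.  The values
   of [share] on pairs that are not edges are irrelevant. *)
Record network (m : nat) := Network {
  node : finType;
  edges : {set node * node};
  inputs : {set node};
  outputs : {set node};
  share : node * node -> 'I_m;
  acyclic : forall s : seq node,
    s != [::] -> ~~ cycle (fun u v => (u, v) \in edges) s;
  inputs_source : forall u v, (u, v) \in edges -> v \notin inputs;
  outputs_sink : forall u v, (u, v) \in edges -> u \notin outputs
}.

Section Network.
Context {R : realType} {m : nat}.
Variable N : network m.
Implicit Types (q p : 'rV[R]_m) (fixed : node N -> option R).

Definition edge_rel : rel (node N) := fun u v => (u, v) \in edges N.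

Definition edges_of (i : 'I_m) : {set node N * node N} :=
  [set e in edges N | share e == i]%SET.

Definition weight q (e : node N * node N) : R := q 0 (share e).

(* [fixed] prescribes the values of some nodes (the inputs, or an internal node
   whose value is treated as an independent variable). *)
Definition node_step q fixed (h : node N -> R) (v : node N) : R :=
  if fixed v is Some t then t else
  let s := \sum_(u | edge_rel u v) weight q (u, v) * h u in
  if v \in outputs N then s else Num.max 0 s.

(* By acyclicity #|node N| rounds reach the unique solution of the node
   equations, see [node_valueE]. *)
Definition node_value q fixed : node N -> R :=
  iter #|node N| (node_step q fixed) (fun=> 0).

Definition input_values (x : {v | v \in inputs N} -> R) : node N -> option R :=
  fun v => omap x (insub v).

Definition net_fun q (x : {v | v \in inputs N} -> R) :
  {v | v \in outputs N} -> R :=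
  fun o => node_value q (input_values x) (val o).

Definition sum_outputs q (x : {v | v \in inputs N} -> R) : R :=
  \sum_(o : {v | v \in outputs N}) net_fun q x o.

Definition ones : {v | v \in inputs N} -> R := fun=> 1.

Definition h_ones q (u : node N) : R := node_value q (input_values ones) u.

Definition override fixed (v : node N) (t : R) : node N -> option R :=
  fun w => if w == v then Some t else fixed w.

(* The value of node u, resp. the sum of the outputs, on the all-ones input, as
   a function of the value of node v. *)
Definition h_of_node q (v u : node N) : R -> R :=
  fun t => node_value q (override (input_values ones) v t) u.

Definition g_of_node q (v : node N) : R -> R :=
  fun t => \sum_(o : {v | v \in outputs N}) h_of_node q v (val o) t.

Definition dh_dh q (u v : node N) : R :=
  derive_within (V := R^o) `[0, +oo[ (h_of_node q v u) (h_ones q v) 1.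

Definition dg_dh q (v : node N) : R :=
  derive_within (V := R^o) `[0, +oo[ (g_of_node q v) (h_ones q v) 1.

Definition io_paths : set (seq (node N)) :=
  [set z | exists u s, [/\ z = u :: s, u \in inputs N, path edge_rel u s
                         & last u s \in outputs N]].

Definition path_edges (z : seq (node N)) : seq (node N * node N) :=
  zip z (behead z).

Definition kappa1 p : 'rV[R]_m := \row_i
  \sum_(e in edges_of i) \sum_(z \in io_paths)
    (e \in path_edges z)%:R *
    \prod_(a <- path_edges z | a != e) weight p a ^+ 2.

(* The sum over e1 <> e2 in E_i, whose summand is symmetric, ranges over the
   unordered pairs S = {e1, e2}.  In the back-propagation formula the pairs of
   edges are ordered, but only the pairs that some path traverses in that order
   contribute, so each {e1, e2} is counted once there as well. *)
Definition kappa2 p : 'rV[R]_m := \row_i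
  (p 0 i ^+ 2 *
   \sum_(S : {set node N * node N} | (S \subset edges_of i) && (#|S| == 2))
     \sum_(z \in io_paths)
       (S \subset path_edges z)%:R *
       \prod_(a <- path_edges z | a \notin S) weight p a ^+ 2).

Lemma connect_acyclic u v : edge_rel u v -> ~~ connect edge_rel v u.
Proof.
move=> uv; apply/negP => /connectP[s vs uE].
have := acyclic (isT : (v :: s) != [::]).
by rewrite (cycle_path v) /= -uE vs andbT => /negP; apply.
Qed.

Lemma node_valueE q fixed (v : node N) :
  node_value q fixed v = node_step q fixed (node_value q fixed) v.
Proof.
pose d w := #|[pred u | connect edge_rel u w]|.
have dlt u w : edge_rel u w -> (d u < d w)%N.
  move=> uw; apply: proper_card; apply/properP; split.
    by apply/fintype.subsetP => y; rewrite !inE => /connect_trans; apply; apply: connect1.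
  by exists w; rewrite !inE ?connect0 ?connect_acyclic.
suff stable k w : (d w <= k)%N ->
    iter k (node_step q fixed) (fun=> 0) w =
    iter k.+1 (node_step q fixed) (fun=> 0) w.
  by apply: stable; exact: max_card.
elim: k w => [|k IH] w dw.
  by move: dw; rewrite leqn0 => /eqP/card0_eq/(_ w); rewrite inE connect0.
set h := iter k (node_step q fixed) (fun=> 0) in IH *.
rewrite -[LHS]/(node_step q fixed h w).
rewrite -[RHS]/(node_step q fixed (node_step q fixed h) w).
rewrite [LHS]/node_step [RHS]/node_step; case: (fixed w) => // /=.
have -> // : \sum_(u | edge_rel u w) weight q (u, w) * h u =
    \sum_(u | edge_rel u w) weight q (u, w) * node_step q fixed h u.
apply: eq_bigr => u uw; congr (_ * _); apply: IH.
by rewrite -ltnS (leq_trans (dlt _ _ uw)).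
Qed.

Lemma finite_io_paths : finite_set io_paths.
Proof.
pose T := {n : 'I_#|node N|.+1 & n.-tuple (node N)}.
apply: (@sub_finite_set _ _ ((fun t : T => tval (tagged t)) @` setT)); last first.
  exact/finite_image/finite_finset.
move=> z [u [s [-> _ us _]]].
have Us : uniq (u :: s).
  elim: s u us => //= w s IH u /andP[uw ws]; rewrite [X in _ && X]IH // andbT.
  apply/negP => us; have /negP := connect_acyclic uw; apply.
  by apply: path_connect us.
have ltz : (size (u :: s) < #|node N|.+1)%N.
  by rewrite ltnS -(card_uniqP Us) max_card.
by exists (Tagged (fun n : 'I_#|node N|.+1 => n.-tuple (node N))
  (in_tuple (u :: s) : (Ordinal ltz).-tuple _)).
Qed.

End Network.

Arguments ones {R m N}.

(* Main.v *)
(* On nonnegative parameters and the all-ones input every ReLU is the identity,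
   so the node values h solve the linear system h = 1_in + A^T h, where A is the
   weighted adjacency matrix, while the weighted sums y of the paths leading to
   the outputs solve the transposed system y = 1_out + A y.  Pairing the two
   solutions gives <h, 1_out> = <1_in, y>: the sum of the outputs is the sum of
   the path weights, a multi-affine polynomial in the edge weights, and the
   product rule along each path gives kappa1.

   For kappa2, let T_S(v) be the sum over the paths from v to an output that
   traverse every edge of S, with the edges of S left out of the product.  It
   solves the transposed system with right hand side
   sum_((u, u') in S) 1_u T_(S \ (u, u'))(u'), because by acyclicity no path from
   u' comes back through (u, u').  Pairing with h, and with the response of the
   linear system to a unit at a node v (whose values are the derivatives
   dh_u / dh_v), computes T for two edges in terms of T for no edge, which is
   the derivative of g with respect to the node values. *)
Require Import Defs.
From mathcomp Require Import functions.

Import Order.TTheory GRing.Theory Num.Theory.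

Local Open Scope classical_set_scope.
Local Open Scope ring_scope.

(** * Finite enumeration of the paths of an acyclic graph *)

Section PathTails.
Local Set Implicit Arguments.
Local Unset Strict Implicit.
Context {m : nat} {N : network m}.
Implicit Types (u v : node N) (s : seq (node N)).

(* A path of length at most k is encoded as its first node v and the sequence
   of its remaining nodes. *)
Fixpoint path_tails k v : seq (seq (node N)) :=
  if k is k'.+1 then
    [::] :: [seq u :: s | u <- enum [pred u | edge_rel v u], s <- path_tails k' u]
  else [:: [::]].

Lemma mem_path_tails k v s :
  (s \in path_tails k v) = path (@edge_rel m N) v s && (size s <= k)%N.
Proof.
elim: k v s => [|k IH] v [|u s] //=; first by rewrite inE andbF.
rewrite inE /=; apply/allpairsPdep/idP => [[u' [s' []]]|/andP[/andP[vu us] ks]].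
  by rewrite mem_enum inE IH => vu /andP[us ks] [-> ->]; rewrite vu us.
by exists u, s; rewrite mem_enum inE IH vu us.
Qed.

Lemma path_tails_uniq k v : uniq (path_tails k v).
Proof.
elim: k v => //= k IH v; apply/andP; split.
  by apply/negP => /allpairsPdep[u [s []]].
apply: allpairs_uniq_dep => [|u _|]; [exact: enum_uniq|exact: IH|].
by move=> [u s] [u' s'] _ _ /= [-> ->].
Qed.

Lemma path_uniq v s : path (@edge_rel m N) v s -> uniq (v :: s).
Proof.
elim: s v => // w s IH v /= /andP[vw ws].
have /= -> := IH _ ws; rewrite andbT; apply/negP => vs.
by have /negP := connect_acyclic vw; apply; apply: path_connect ws _ vs.
Qed.

Lemma path_size_lt v s : path (@edge_rel m N) v s -> (size s < #|node N|)%N.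
Proof.
by move=> /path_uniq us; rewrite -[(size s).+1]/(size (v :: s)) -(card_uniqP us) max_card.
Qed.

(** Paths are simple, so they have fewer than [#|node N|] edges and a larger length bound adds none.
    This lets [path_sum] be unfolded by one step without its bound dropping. *)
Lemma perm_path_tails v :
  perm_eq (path_tails #|node N| v) (path_tails #|node N|.+1 v).
Proof.
apply: uniq_perm; [exact: path_tails_uniq..|move=> s].
rewrite !mem_path_tails; case: (boolP (path _ _ _)) => //= /path_size_lt/ltnW sN.
by rewrite sN leqW.
Qed.

Lemma path_edges_cons v u s : path_edges (v :: u :: s) = (v, u) :: path_edges (u :: s).
Proof. by []. Qed.

Lemma mem_path_edges v s (a : node N * node N) : a \in path_edges (v :: s) -> a.2 \in s.
Proof.
elim: s v => // u s IH v; rewrite path_edges_cons !inE => /predU1P[->|/IH ->].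
  by rewrite eqxx.
by rewrite orbT.
Qed.

Lemma path_edges_uniq v s : path (@edge_rel m N) v s -> uniq (path_edges (v :: s)).
Proof. by move=> /path_uniq /= /andP[_ us]; rewrite zip_uniqr. Qed.

Lemma path_edgesP v s (a : node N * node N) : path (@edge_rel m N) v s ->
  a \in path_edges (v :: s) -> a \in edges N.
Proof.
elim: s v => // u s IH v /= /andP[vu us]; rewrite path_edges_cons inE.
by move=> /predU1P[->|/(IH _ us)].
Qed.

End PathTails.

(** * Weighted path sums and the transposed linear system *)

Section PathSum.
Local Set Implicit Arguments.
Local Unset Strict Implicit.
Context {R : comNzRingType} {m : nat} {N : network m}.
Variable w : node N * node N -> R.
Implicit Types (u v : node N) (s : seq (node N)) (S : {set node N * node N}).

(** On a path with distinct edges, this is the mixed partial derivative of the product of the edge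
    weights with respect to the weights of the edges in [S]. *)
Definition path_weight S (z : seq (node N)) : R :=
  (S \subset path_edges z)%:R * \prod_(a <- path_edges z | a \notin S) w a.

Definition path_sum S v : R :=
  \sum_(s <- path_tails #|node N| v | last v s \in outputs N)
    path_weight S (v :: s).

Lemma path_weight_notin S u v s : path (@edge_rel m N) v s -> (u, v) \in S ->
  path_weight S (v :: s) = 0.
Proof.
move=> vs uvS; rewrite /path_weight.
case: fintype.subsetP => [/(_ _ uvS)|]; last by rewrite mul0r.
by move=> /mem_path_edges /= vins; have /= := path_uniq vs; rewrite vins.
Qed.

Lemma path_sum_notin S u v : (u, v) \in S -> path_sum S v = 0.
Proof.
move=> uvS; rewrite /path_sum big_seq_cond big1 // => s.
by rewrite mem_path_tails => /andP[/andP[vs _] _]; apply: path_weight_notin uvS.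
Qed.

(** The first edge does not recur on a simple path: either it is a marked edge, which is then used
    up, or it contributes its weight. *)
Lemma path_weight_cons S v u s : path (@edge_rel m N) v (u :: s) ->
  path_weight S (v :: u :: s) =
  if (v, u) \in S then path_weight (S :\ (v, u)) (u :: s)
  else w (v, u) * path_weight S (u :: s).
Proof.
move=> vus; have /= /andP[vuNs _] := path_edges_uniq vus.
rewrite /path_weight path_edges_cons big_cons.
case: (boolP ((v, u) \in S)) => vuS /=; last first.
  rewrite mulrCA; congr (_ * (_%:R * _)); congr nat_of_bool.
  apply/fintype.subsetP/fintype.subsetP => H a aS; have := H a aS; rewrite inE.
    by case/predU1P => // ea; rewrite -ea aS in vuS.
  by move=> ->; rewrite orbT.
congr (_%:R * _).
  congr nat_of_bool; apply/fintype.subsetP/fintype.subsetP => H a.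
    by rewrite !inE => /andP[/negPf aNvu /H]; rewrite inE aNvu.
  by move=> aS; rewrite inE; case: eqVneq => //= aNvu; apply: H; rewrite !inE aNvu.
rewrite [LHS]big_seq_cond [RHS]big_seq_cond; apply: eq_bigl => a.
rewrite !inE; case: (boolP (a \in path_edges _)) => //= a_in.
by have /negPf -> : a != (v, u) by apply: contraNneq vuNs => <-.
Qed.

Lemma path_sum_rec S v :
  path_sum S v = ((S == finset.set0) && (v \in outputs N))%:R +
    \sum_(u | edge_rel v u)
      (if (v, u) \in S then path_sum (S :\ (v, u)) u else w (v, u) * path_sum S u).
Proof.
rewrite {1}/path_sum (perm_big _ (perm_path_tails v)) /= big_mkcond big_cons /=.
rewrite big_allpairs_dep big_enum /=; congr (_ + _).
  rewrite /path_weight big_nil mulr1 andbC; case: ifP => //= _.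
  congr (_%:R); congr nat_of_bool; rewrite -finset.subset0.
  by apply: eq_subset_r => a; rewrite !inE.
apply: eq_big => [u|u]; first by rewrite inE.
rewrite inE => vu; rewrite -big_mkcond /= big_seq_cond.
under eq_bigr => s.
  rewrite mem_path_tails => /andP[/andP[us _] _].
  rewrite path_weight_cons /= ?us ?andbT //.
  over.
by rewrite -big_seq_cond; case: ifP => _ //; rewrite -mulr_sumr.
Qed.

(** Turns the case distinction of [path_sum_rec] into a linear system with a source term: adding
    [w (v, u) * path_sum S u] for a marked edge [(v, u)] is harmless, since this term is zero by
    [path_sum_notin]. *)
Lemma path_sum_recE S v : S \subset edges N ->
  path_sum S v = ((S == finset.set0) && (v \in outputs N))%:R +
    \sum_(a in S) (a.1 == v)%:R * path_sum (S :\ a) a.2 +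
    \sum_(u | edge_rel v u) w (v, u) * path_sum S u.
Proof.
move=> /fintype.subsetP SE; rewrite path_sum_rec -addrA; congr (_ + _).
have -> : \sum_(a in S) (a.1 == v)%:R * path_sum (S :\ a) a.2 =
    \sum_(u | edge_rel v u) ((v, u) \in S)%:R * path_sum (S :\ (v, u)) u.
  rewrite (bigID (fun a => a.1 == v)) /= [X in _ + X]big1 ?addr0; last first.
    by move=> a /andP[_ /negPf ->]; rewrite mul0r.
  rewrite (reindex_onto (fun u => (v, u)) snd) /=; last first.
    by move=> [a1 a2] /= /andP[_ /eqP ->].
  rewrite [RHS]big_mkcond [LHS]big_mkcond /=; apply: eq_bigr => u _.
  rewrite !eqxx !andbT mul1r; case: ifPn => vuS; last by case: ifP; rewrite ?mul0r.
  by have := SE _ vuS; rewrite /edge_rel => ->; rewrite mul1r.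
rewrite -big_split /=; apply: eq_bigr => u _; case: ifP => vuS.
  by rewrite (path_sum_notin vuS) mul1r mulr0 addr0.
by rewrite mul0r add0r.
Qed.

(* Both sides equal the pairing of x with the path sums, up to the common term
   [\sum_(edges (u, v)) x u * w (u, v) * path_sum S v]. *)
Lemma path_sum_pairing S (x b : node N -> R) : S \subset edges N ->
  (forall v, x v = b v + \sum_(u | edge_rel u v) w (u, v) * x u) ->
  \sum_v b v * path_sum S v =
    (S == finset.set0)%:R * (\sum_(v in outputs N) x v) +
    \sum_(a in S) x a.1 * path_sum (S :\ a) a.2.
Proof.
move=> SE xE.
pose M := \sum_v \sum_(u | edge_rel u v) w (u, v) * x u * path_sum S v.
have E1 : \sum_v x v * path_sum S v = \sum_v b v * path_sum S v + M.
  rewrite -big_split /=; apply: eq_bigr => v _.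
  by rewrite {1}xE mulrDl mulr_suml.
have E2 : \sum_v x v * path_sum S v =
    (S == finset.set0)%:R * (\sum_(v in outputs N) x v) +
    \sum_(a in S) x a.1 * path_sum (S :\ a) a.2 + M.
  under eq_bigr => v _ do rewrite (path_sum_recE _ SE) !mulrDr.
  rewrite !big_split /=; congr (_ + _ + _).
  - rewrite mulr_sumr [RHS]big_mkcond; apply: eq_bigr => v _ /=.
    by case: (v \in outputs N); rewrite ?andbT ?andbF ?mulr0 // mulrC.
  - under eq_bigr => v _ do rewrite mulr_sumr.
    rewrite exchange_big /=; apply: eq_bigr => a aS.
    rewrite (bigD1 a.1) //= eqxx mul1r big1 ?addr0 // => v /negPf.
    by rewrite eq_sym => ->; rewrite mul0r mulr0.
  - rewrite /M [RHS](exchange_big_dep predT) //=; apply: eq_bigr => u _.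
    by rewrite mulr_sumr; apply: eq_bigr => v _; rewrite mulrCA mulrA.
by apply: (addIr M); rewrite -E1.
Qed.

End PathSum.

(** * Computing one-sided derivatives *)

Section OneSided.
Local Set Implicit Arguments.
Local Unset Strict Implicit.
Context {R : realType} {V : normedModType R}.

(** All positive increments are admissible, so the filter is coarser than the right neighbourhoods
    of 0. Properness makes the limit unique. *)
Lemma increments_proper (D : set V) (a v : V) :
  (forall h : R, 0 <= h -> D (h *: v + a)) -> ProperFilter (increments D a v).
Proof.
move=> Dv; have inc_filter : Filter (increments D a v) by exact: within_filter.
apply: Build_ProperFilter_ex => P; rewrite /increments /within /= => HP.
have : 0^'+ P.
  have {}HP : \forall h \near (0 : R), h != 0 -> D (h *: v + a) -> P h := HP.
  have Pr : \forall h \near (0 : R), 0 < h -> P h; last exact: Pr.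
  by apply: filterS HP => h /= hP h0; apply: hP (Dv _ (ltW h0)); rewrite gt_eqF.
exact: filter_ex.
Qed.

(** [F] extends the restriction of [f] to the line through [a] to a function differentiable on both
    sides of 0; the ReLU network itself need not be. *)
Lemma is_derive_within (D : set V) (f : V -> R) (a v : V) (F : R -> R) (dF : R) :
  (forall h : R, 0 <= h -> D (h *: v + a)) ->
  (forall h : R, D (h *: v + a) -> f (h *: v + a) = F h) ->
  is_derive (0 : R) (1 : R) F dF ->
  derivable_within D f a v /\ derive_within D f a v = dF.
Proof.
move=> Dv fF [dvF dFE]; have incP := increments_proper Dv.
suff q_cvg : diff_quotient f a v @ increments D a v --> dF.
  by split; [apply/cvg_ex; exists dF|exact: cvg_lim q_cvg].
have Fcvg : (fun h : R => h^-1 *: ((F \o shift 0) (h *: (1 : R)) - F 0)) @ 0^' --> dF.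
  by rewrite -dFE; exact: dvF.
have fa : f a = F 0.
  by rewrite -fF ?scale0r ?add0r //; have := Dv 0 (lexx _); rewrite scale0r add0r.
(* Restricting the increments refines the filter, and on them the quotients of [f] and [F] agree. *)
apply: cvg_trans (cvg_trans (cvg_app _ (cvg_within [set h | D (h *: v + a)])) Fcvg).
apply: near_eq_cvg; rewrite near_withinE; apply: nearW => h /= Dh.
by rewrite /diff_quotient /= fF // fa addr0 [h *: 1]mulr1.
Qed.

End OneSided.

Lemma is_derive_prod_affine (R : realType) (I : eqType) (l : seq I) (w c : I -> R) :
  uniq l ->
  is_derive (0 : R) (1 : R) (fun h => \prod_(a <- l) (w a + h * c a))
    (\sum_(e <- l) c e * \prod_(a <- l | a != e) w a).
Proof.
elim: l => [|b l IH] /=.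
  move=> _; rewrite big_nil.
  have -> : (fun h : R => \prod_(a <- [::]) (w a + h * c a)) = cst 1.
    by apply/funext => h; rewrite big_nil.
  exact: is_derive_cst.
move=> /andP[bNl ul]; have {}IH := IH ul.
have -> : (fun h : R => \prod_(a <- b :: l) (w a + h * c a)) =
    (fun h => w b + h * c b) * (fun h => \prod_(a <- l) (w a + h * c a)).
  by apply/funext => h; rewrite big_cons.
have db : is_derive (0 : R) (1 : R) (fun h : R => w b + h * c b) (c b).
  have -> : (fun h : R => w b + h * c b) = cst (w b) + (id * cst (c b)) by [].
  by apply: is_derive_eq; rewrite /= scaler0 !add0r /GRing.scale /= mulr1.
apply: is_derive_eq.
rewrite /GRing.scale /= mul0r addr0 addrC big_cons big_cons eqxx /=.
under [X in X * c b]eq_bigr do rewrite mul0r addr0.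
congr (_ + _).
  rewrite mulrC; congr (_ * _); rewrite big_seq_cond [RHS]big_seq_cond /=.
  apply: eq_bigl => a; rewrite andbT; case: (boolP (a \in l)) => //= al.
  by apply/esym; apply: contraNneq bNl => <-.
rewrite mulr_sumr; apply: eq_big_seq => e el; rewrite big_cons.
have -> /= : b != e by apply: contraNneq bNl => ->.
by rewrite mulrCA.
Qed.

(** * Node values on nonnegative parameters and their linear response *)

Section NodeValues.
Local Set Implicit Arguments.
Local Unset Strict Implicit.
Context {R : realType} {m : nat} {N : network m}.
Implicit Types (q : 'rV[R]_m) (u v : node N) (fixed : node N -> option R).

Lemma node_step_nneg q fixed (h : node N -> R) v :
  nonneg_row q -> (forall u, 0 <= h u) ->
  node_step q fixed h v =
  if fixed v is Some t then t else \sum_(u | edge_rel u v) weight q (u, v) * h u.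
Proof.
move=> q0 h0; rewrite /node_step; case: (fixed v) => // /=; case: ifP => // _.
by apply/max_idPr/sumr_ge0 => u _; apply: mulr_ge0; [exact: q0|exact: h0].
Qed.

Lemma iter_node_step_ge0 q fixed k v :
  nonneg_row q -> (forall u t, fixed u = Some t -> 0 <= t) ->
  0 <= iter k (node_step q fixed) (fun=> 0) v.
Proof.
move=> q0 f0; elim: k v => //= k IH v; rewrite node_step_nneg //.
case E: (fixed v) => [t|]; first exact: f0 E.
by apply: sumr_ge0 => u _; apply: mulr_ge0; [exact: q0|exact: IH].
Qed.

Lemma input_valuesE (x : {v | v \in inputs N} -> R) (t : R) v : (forall i, x i = t) ->
  input_values x v = if v \in inputs N then Some t else None.
Proof.
by move=> xt; rewrite /input_values; case: insubP => [i -> _|/negPf -> //] /=; rewrite xt.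
Qed.

Lemma input_sum0 q v (h : node N -> R) : v \in inputs N ->
  \sum_(u | edge_rel u v) weight q (u, v) * h u = 0.
Proof.
by move=> vi; rewrite big_pred0 // => u; apply/negP => /inputs_source; rewrite vi.
Qed.

Lemma ones_fixed_ge0 v (t : R) : input_values (N := N) (@ones R m N) v = Some t -> 0 <= t.
Proof. by rewrite (@input_valuesE _ 1) //; case: ifP => // _ [<-]. Qed.

Lemma h_ones_ge0 q v : nonneg_row q -> 0 <= h_ones q v.
Proof. by move=> q0; apply: iter_node_step_ge0 => // u t; apply: ones_fixed_ge0. Qed.

Lemma h_onesE q v : nonneg_row q ->
  h_ones q v = (v \in inputs N)%:R +
    \sum_(u | edge_rel u v) weight q (u, v) * h_ones q u.
Proof.
move=> q0; rewrite {1}/h_ones node_valueE node_step_nneg => [| |u]; last 2 first.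
- exact: q0.
- exact: h_ones_ge0.
rewrite (@input_valuesE _ 1) //; case: ifPn => vi; last by rewrite add0r.
by rewrite input_sum0 ?addr0.
Qed.

(** The Green function of the linear system: the response at [u] to a unit held at [v] while all
    other inputs are zero. *)
Definition green q v u : R :=
  node_value q (override (input_values (fun=> 0)) v 1) u.

Lemma green_fixed_ge0 v u (t : R) :
  override (input_values (N := N) (fun=> 0)) v 1 u = Some t -> 0 <= t.
Proof.
rewrite /override; case: ifP => _; first by move=> [<-].
by rewrite (@input_valuesE _ 0) //; case: ifP => // _ [<-].
Qed.

Lemma green_ge0 q v u : nonneg_row q -> 0 <= green q v u.
Proof. by move=> q0; apply: iter_node_step_ge0 => // w t; apply: green_fixed_ge0. Qed.

Lemma green_unreachable q v u : nonneg_row q -> ~~ connect (@edge_rel m N) v u ->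
  green q v u = 0.
Proof.
move=> q0; rewrite /green /node_value; elim: #|node N| u => //= k IH u vNu.
rewrite node_step_nneg // => [|w]; last first.
  by apply: iter_node_step_ge0 => // w' t; apply: green_fixed_ge0.
rewrite /override; case: eqVneq vNu => [->|_ vNu]; first by rewrite connect0.
rewrite (@input_valuesE _ 0) //; case: ifP => // _; apply: big1 => w wu.
rewrite IH ?mulr0 //; apply: contra vNu => vw.
exact: connect_trans vw (connect1 wu).
Qed.

(** Holding [v] at 1 amounts to adding a unit source there: the predecessors of [v] are not
    reachable from [v], so their values are zero and the sum at [v] vanishes. *)
Lemma greenE q v u : nonneg_row q ->
  green q v u = (u == v)%:R +
    \sum_(w | edge_rel w u) weight q (w, u) * green q v w.
Proof.
move=> q0; rewrite {1}/green node_valueE node_step_nneg => [| |w]; last 2 first.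
- exact: q0.
- exact: green_ge0.
rewrite /override; case: eqVneq => [->|_]; last first.
  rewrite add0r (@input_valuesE _ 0) //; case: ifPn => // ui.
  by rewrite input_sum0.
rewrite big1 ?addr0 // => w wv; rewrite green_unreachable ?mulr0 //.
exact: connect_acyclic.
Qed.

(** Superposition: with every ReLU acting as the identity, values are linear in the prescribed ones.
    The identity already holds after each round of the iteration, hence the induction on rounds. *)
Lemma h_of_nodeE q v u (t : R) : nonneg_row q -> 0 <= t ->
  h_of_node q v u t = h_of_node q v u 0 + t * green q v u.
Proof.
move=> q0 t0; rewrite /h_of_node /green /node_value.
have fix0 s : 0 <= s -> forall w r,
    override (input_values (@ones R m N)) v s w = Some r -> 0 <= r.
  move=> s0 w r; rewrite /override; case: ifP => _; first by move=> [<-].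
  exact: ones_fixed_ge0.
elim: #|node N| u => /= [|k IH] u; first by rewrite mulr0 addr0.
rewrite !node_step_nneg //; try by move=> w; apply: iter_node_step_ge0 => //;
  first [exact: fix0 | move=> ? ?; exact: green_fixed_ge0].
rewrite /override; case: eqVneq => _; first by rewrite mulr1 add0r.
rewrite (@input_valuesE _ 1) // (@input_valuesE _ 0) //; case: ifP => _.
  by rewrite mulr0 addr0.
rewrite mulr_sumr -big_split /=; apply: eq_bigr => w _.
by rewrite IH mulrDr mulrCA.
Qed.

Lemma sum_over_outputs (F : node N -> R) :
  \sum_(o : {v | v \in outputs N}) F (val o) = \sum_(v in outputs N) F v.
Proof. by rewrite [RHS]big_sub; apply: eq_bigr. Qed.

End NodeValues.

(** The ordered pairs are grouped by their underlying set; the fibre over a two-element set consists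
    of its two orderings. *)
Lemma sum_unordered_pairs (R : nmodType) (T : finType) (E : {set T})
    (Phi : {set T} -> R) (f : T -> T -> R) :
  (forall a b, a \in E -> b \in E -> a != b ->
     Phi [set a; b]%SET = f a b + f b a) ->
  \sum_(S : {set T} | (S \subset E) && (#|S| == 2)) Phi S =
  \sum_(a in E) \sum_(b in E | a != b) f a b.
Proof.
move=> PhiE; rewrite pair_big_dep /=.
rewrite [RHS](partition_big (fun x : T * T => [set x.1; x.2]%SET)
  (fun S => (S \subset E) && (#|S| == 2))) /=; last first.
  move=> [a b] /= /and3P[aE bE ab]; rewrite cards2 ab eqxx andbT.
  by apply/fintype.subsetP => x; rewrite !inE => /orP[]/eqP ->.
apply: eq_bigr => S /andP[SE /cards2P[a [b [ab SEab]]]]; subst S.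
have aE : a \in E by apply: (fintype.subsetP SE); rewrite !inE eqxx.
have bE : b \in E by apply: (fintype.subsetP SE); rewrite !inE eqxx orbT.
rewrite PhiE // (bigD1 (a, b)) /=; last by rewrite aE bE ab eqxx.
rewrite (bigD1 (b, a)) /=; last first.
  rewrite aE bE eq_sym ab finset.setUC eqxx /=.
  by apply/eqP => -[ba _]; rewrite ba eqxx in ab.
rewrite big1 ?addr0 // => -[x y] /=.
case/andP => /andP[/andP[/and3P[_ _ xy] /eqP xyE] xyab] xyba; exfalso.
have : x \in [set a; b]%SET by rewrite -xyE !inE eqxx.
have : y \in [set a; b]%SET by rewrite -xyE !inE eqxx orbT.
rewrite !inE => /orP[]/eqP yE /orP[]/eqP xE; subst x y;
  by rewrite ?eqxx in xy xyab xyba.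
Qed.

Lemma is_derive_big (R : realType) (I : eqType) (r : seq I) (f : I -> R -> R)
    (df : I -> R) (x : R) :
  (forall i, i \in r -> is_derive x (1 : R) (f i) (df i)) ->
  is_derive x (1 : R) (fun y => \sum_(i <- r) f i y) (\sum_(i <- r) df i).
Proof.
elim: r => [_|i r IH dr].
  rewrite big_nil.
  have -> : (fun y => \sum_(i <- [::]) f i y) = cst 0.
    by apply/funext => y; rewrite big_nil.
  exact: is_derive_cst.
have -> : (fun y => \sum_(j <- i :: r) f j y) = f i + (fun y => \sum_(j <- r) f j y).
  by apply/funext => y; rewrite big_cons.
rewrite big_cons; have := dr i (mem_head _ _).
have : is_derive x (1 : R) (fun y => \sum_(i <- r) f i y) (\sum_(i <- r) df i).
  by apply: IH => j jr; apply: dr; rewrite inE jr orbT.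
by move=> ? ?; apply: is_deriveD.
Qed.

(** * Input-output paths as a duplicate-free sequence *)

Section IoPaths.
Local Set Implicit Arguments.
Local Unset Strict Implicit.
Context {m : nat} (N : network m).

Definition io_seq : seq (seq (node N)) :=
  [seq z <- [seq v :: s | v <- enum (inputs N), s <- path_tails #|node N| v]
     | if z is v :: s then last v s \in outputs N else false].

Lemma io_seqP v s : v :: s \in io_seq -> path (@edge_rel m N) v s.
Proof.
rewrite mem_filter => /andP[_] /allpairsPdep[u [t [_]]].
by rewrite mem_path_tails => /andP[ut _] [-> ->].
Qed.

Lemma io_seq_path_edges z : z \in io_seq ->
  uniq (path_edges z) /\ {subset path_edges z <= edges N}.
Proof.
case: z => [|v s] zio; first by rewrite mem_filter in zio.
have vs := io_seqP zio; split; first exact: path_edges_uniq.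
by move=> a; apply: path_edgesP.
Qed.

Lemma io_pathsE (R : nmodType) (F : seq (node N) -> R) :
  \sum_(z \in @io_paths m N) F z = \sum_(z <- io_seq) F z.
Proof.
rewrite [RHS]fsbig_seq; last first.
  rewrite /io_seq filter_uniq // allpairs_uniq_dep ?enum_uniq // => [v _|].
    exact: path_tails_uniq.
  by move=> [u s] [u' s'] _ _ /= [-> ->].
suff -> : @io_paths m N = [set` io_seq] by []; apply/seteqP; split => z /=.
  move=> [u [s [-> ui us uo]]]; rewrite mem_filter uo /=.
  apply/allpairsPdep; exists u, s; split; rewrite ?mem_enum //.
  by rewrite mem_path_tails us (ltnW (path_size_lt us)).
rewrite mem_filter; case: z => // v s /andP[vso] /allpairsPdep[u [t [ui ut]]].
rewrite mem_enum in ui; rewrite mem_path_tails in ut.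
by move: ut => /andP[ut _] [vu st]; subst v s; exists u, t.
Qed.

Lemma sum_io_seq (R : nmodType) (F : seq (node N) -> R) :
  \sum_(z <- io_seq) F z =
  \sum_(v in inputs N)
    \sum_(s <- path_tails #|node N| v | last v s \in outputs N) F (v :: s).
Proof.
rewrite big_filter big_mkcond big_allpairs_dep big_enum /=.
by apply: eq_bigr => v _; rewrite -big_mkcond.
Qed.

End IoPaths.

(** * Derivatives of the network and path sums through one or two edges *)

Section Kappa.
Local Set Implicit Arguments.
Local Unset Strict Implicit.
Context {R : realType} {m : nat} {N : network m}.
Implicit Types (q : 'rV[R]_m) (u v : node N).

(** The pairing for no marked edge, with the node values as solution and the indicator of the inputs
    as source. *)
Lemma g_ones_path_weight q : nonneg_row q ->
  sum_outputs q (@ones R m N) =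
  \sum_(z <- io_seq N) \prod_(a <- path_edges z) weight q a.
Proof.
move=> q0; rewrite /sum_outputs /net_fun.
rewrite (sum_over_outputs (node_value q (input_values ones))).
have := path_sum_pairing (finset.sub0set _) (fun v => h_onesE v q0).
rewrite big_set0 addr0 eqxx mul1r => <-.
rewrite sum_io_seq [RHS]big_mkcond; apply: eq_bigr => v _.
case: ifP => _; last by rewrite mul0r.
rewrite mul1r; apply: eq_bigr => s _; rewrite /path_weight.
have -> : finset.set0 \subset path_edges (v :: s).
  by apply/fintype.subsetP => a; rewrite inE.
rewrite mul1r.
by apply: eq_bigl => a; rewrite inE.
Qed.

Lemma dg_within q (i : 'I_m) : nonneg_row q ->
  let dg := \sum_(e in edges_of N i) \sum_(z <- io_seq N)
    (e \in path_edges z)%:R * \prod_(a <- path_edges z | a != e) weight q a in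
  derivable_within (@nonneg_row R m) (fun q => sum_outputs q (@ones R m N)) q
    (delta_mx 0 i) /\
  derive_within (@nonneg_row R m) (fun q => sum_outputs q (@ones R m N)) q
    (delta_mx 0 i) = dg.
Proof.
(* [c a] is the rate at which the weight of [a] changes when parameter [i] moves. *)
move=> q0 dg; pose c (a : node N * node N) : R := (share a == i)%:R.
have -> : dg = \sum_(z <- io_seq N) \sum_(e <- path_edges z)
    c e * \prod_(a <- path_edges z | a != e) weight q a.
  rewrite /dg exchange_big /=; apply: eq_big_seq => z /io_seq_path_edges[uz zE].
  rewrite big_uniq // [LHS]big_mkcond [RHS]big_mkcond; apply: eq_bigr => e _ /=.
  rewrite /c inE; case: (boolP (e \in path_edges z)) => [/zE ->|_] /=.
    by case: (share e == i); rewrite ?mul1r ?mul0r.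
  by rewrite mul0r if_same.
apply: (@is_derive_within _ _ _ _ _ _
  (fun h => \sum_(z <- io_seq N) \prod_(a <- path_edges z) (weight q a + h * c a))).
- by move=> h h0 j; rewrite !mxE addr_ge0 ?mulr_ge0 ?ler0n.
- move=> h q'0; rewrite g_ones_path_weight //; apply: eq_bigr => z _.
  by apply: eq_bigr => a _; rewrite /weight !mxE eqxx /= addrC.
- apply: is_derive_big => z /io_seq_path_edges[uz _].
  exact: is_derive_prod_affine.
Qed.

Lemma affine_within (f : R -> R) (A B a : R) : 0 <= a ->
  (forall t, 0 <= t -> f t = A + t * B) ->
  derivable_within (V := R^o) `[0, +oo[ f a 1 /\
  derive_within (V := R^o) `[0, +oo[ f a 1 = B.
Proof.
move=> a0 fE; apply: (@is_derive_within _ _ _ _ _ _ (fun h => A + (h + a) * B)).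
- by move=> h h0 /=; rewrite in_itv /= andbT addr_ge0 // [h *: 1]mulr1.
- by move=> h /=; rewrite in_itv /= andbT [h *: 1]mulr1 => /fE.
have -> : (fun h => A + (h + a) * B) = cst A + (id + cst a) * cst B by [].
apply: is_derive_eq.
by rewrite /GRing.scale /= !mulr0 !add0r addr0 mulr1.
Qed.

Lemma dh_dh_within q u v : nonneg_row q ->
  derivable_within (V := R^o) `[0, +oo[ (h_of_node q v u) (h_ones q v) 1 /\
  dh_dh q u v = green q v u.
Proof.
move=> q0; apply: (affine_within (A := h_of_node q v u 0)).
  exact: h_ones_ge0.
by move=> t t0; apply: h_of_nodeE.
Qed.

(** By superposition the slope is the sum of [green q v] over the outputs; pairing with a unit
    source at [v] turns it into a path sum. *)
Lemma dg_dh_within q v : nonneg_row q ->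
  derivable_within (V := R^o) `[0, +oo[ (g_of_node q v) (h_ones q v) 1 /\
  dg_dh q v = path_sum (weight q) finset.set0 v.
Proof.
move=> q0; apply: (affine_within (A := g_of_node q v 0)); first exact: h_ones_ge0.
move=> t t0; rewrite /g_of_node.
under eq_bigr => o _ do rewrite h_of_nodeE //.
rewrite big_split /=; congr (_ + _).
rewrite -mulr_sumr (sum_over_outputs (green q v)); congr (_ * _).
have := path_sum_pairing (finset.sub0set _) (fun u => greenE v u q0).
rewrite big_set0 addr0 eqxx mul1r => <-.
by rewrite (bigD1 v) //= eqxx mul1r big1 ?addr0 // => u /negPf ->; rewrite mul0r.
Qed.

(** A path through [e] splits there: the part before [e] is collected by the Green function, the
    part after it by the unmarked path sum. *)
Lemma path_sum1 q v (e : node N * node N) : nonneg_row q -> e \in edges N ->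
  path_sum (weight q) [set e]%SET v =
  green q v e.1 * path_sum (weight q) finset.set0 e.2.
Proof.
move=> q0 eE; have SE : [set e]%SET \subset edges N by rewrite finset.sub1set.
have := path_sum_pairing SE (fun u => greenE v u q0).
rewrite big_set1 finset.setDv.
have /negPf -> : [set e]%SET != finset.set0 by apply/finset.set0Pn; exists e; rewrite inE.
rewrite mul0r add0r => <-.
by rewrite (bigD1 v) //= eqxx mul1r big1 ?addr0 // => u /negPf ->; rewrite mul0r.
Qed.

(** The two terms are the two orders in which a path can traverse the edges; acyclicity leaves at
    most one of them nonzero. *)
Lemma path_sum2 q (e1 e2 : node N * node N) : nonneg_row q ->
  e1 \in edges N -> e2 \in edges N -> e1 != e2 ->
  \sum_(v in inputs N) path_sum (weight q) [set e1; e2]%SET v =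
  h_ones q e1.1 * green q e1.2 e2.1 * path_sum (weight q) finset.set0 e2.2 +
  h_ones q e2.1 * green q e2.2 e1.1 * path_sum (weight q) finset.set0 e1.2.
Proof.
move=> q0 e1E e2E e12.
have SE : [set e1; e2]%SET \subset edges N.
  by apply/fintype.subsetP => x; rewrite !inE => /orP[]/eqP ->.
have := path_sum_pairing SE (fun u => h_onesE u q0).
have /negPf -> : [set e1; e2]%SET != finset.set0.
  by apply/finset.set0Pn; exists e1; rewrite !inE eqxx.
rewrite mul0r add0r finset.big_setU1 ?inE //= big_set1.
have -> : [set e1; e2]%SET :\ e1 = [set e2]%SET.
  by rewrite finset.setU1K // inE.
have -> : [set e1; e2]%SET :\ e2 = [set e1]%SET.
  by rewrite finset.setUC finset.setU1K // inE eq_sym.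
rewrite !path_sum1 // !mulrA => <-.
rewrite [LHS]big_mkcond; apply: eq_bigr => v _.
by case: ifP => _; rewrite ?mul1r ?mul0r.
Qed.

End Kappa.

Theorem theorem36 (R : realType) (m : nat) (N : network m) (p : 'rV[R]_m) :
  let ptilde : 'rV[R]_m := \row_i (p 0 i ^+ 2) in
  let g (q : 'rV[R]_m) := @sum_outputs R m N q in
  [/\ (forall i, derivable_within (@nonneg_row R m) (fun q => g q ones)
                   ptilde (delta_mx 0 i)),
      kappa1 N p =
        gradient_within (@nonneg_row R m) (fun q => g q ones) ptilde,
      (forall v : node N, derivable_within (V := R^o) `[0, +oo[
         (g_of_node ptilde v) (h_ones ptilde v) 1),
      (forall u v : node N, derivable_within (V := R^o) `[0, +oo[
         (h_of_node ptilde v u) (h_ones ptilde v) 1)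
    & forall i, kappa2 N p 0 i =
        \sum_(e in edges_of N i) \sum_(e' in edges_of N i | e != e')
          ptilde 0 i * dg_dh ptilde e'.2 * dh_dh ptilde e'.1 e.2 *
          h_ones ptilde e.1].
Proof.
move=> ptilde g.
have q0 : nonneg_row ptilde by move=> i; rewrite mxE sqr_ge0.
have wE (a : node N * node N) : weight p a ^+ 2 = weight ptilde a.
  by rewrite /weight mxE.
split.
- by move=> i; have [] := dg_within (N := N) i q0.
- apply/rowP => i; rewrite !mxE; have [_ ->] := dg_within (N := N) i q0.
  apply: eq_bigr => e _; rewrite io_pathsE; apply: eq_bigr => z _.
  by congr (_ * _); apply: eq_bigr => a _; exact: wE.
- by move=> v; have [] := dg_dh_within v q0.
- by move=> u v; have [] := dh_dh_within u v q0.
- move=> i; rewrite !mxE.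
  (* The contribution of the paths that traverse [e] before [e']. *)
  pose f (e e' : node N * node N) := h_ones ptilde e.1 * green ptilde e.2 e'.1 *
    path_sum (weight ptilde) finset.set0 e'.2.
  rewrite (sum_unordered_pairs _ _ _ _ f) => [|a b].
    rewrite mulr_sumr; apply: eq_bigr => e _; rewrite mulr_sumr.
    apply: eq_bigr => e' _.
    have [_ ->] := dg_dh_within e'.2 q0; have [_ ->] := dh_dh_within e'.1 e.2 q0.
    rewrite /f; move: (p 0 i ^+ 2) => x; rewrite -!mulrA; congr (_ * _).
    by rewrite [LHS]mulrC -mulrA mulrCA.
  rewrite !inE => /andP[aE _] /andP[bE _] ab.
  rewrite -path_sum2 // io_pathsE sum_io_seq.
  apply: eq_bigr => v _; apply: eq_bigr => s _; rewrite /path_weight.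
  by congr (_ * _); apply: eq_bigr => a' _; exact: wE.
Qed.
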